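(* Let $m, n, s, p, q$ be integers with $1 \leq s < n$ and $0 \leq p < q \leq (m-1)n$. Then there exists an $s$-ocycle for $\mathcal{B}_p^q(m,n)$.
   Context: An $m$-ary word (string) of length $n$ is a sequence $x = x_1x_2\ldots x_n$ with each $x_i \in \{0,1,\ldots,m-1\}$. Its weight is $wt(x) = \sum_{i=1}^n x_i$ (sum of integers). For $p<q$, $\mathcal{B}_p^q(m,n)$ denotes the set of all $m$-ary words $x$ of length $n$ with $p \leq wt(x) \leq q$. For a set $S$ of strings of length $n$ and an integer $s$ with $1 \le s \le n-1$, an $s$-overlap cycle ($s$-ocycle) for $S$ is a cyclic ordering of $S$, in which each element of $S$ appears exactly once, such that whenever $x = x_1\ldots x_n$ is followed by $y = y_1 \ldots y_n$ one has $x_{n-s+i} = y_i$ for all $i \in \{1,\ldots,s\}$ (the last $s$ letters of $x$ equal the first $s$ letters of $y$). The ordering being cyclic means that the last element of the ordering is followed by the first, and the overlap condition is also required there. *)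

(* Defs.v *)
From mathcomp Require Import all_boot.

Set Implicit Arguments.
Unset Strict Implicit.
Unset Printing Implicit Defensive.

Definition word (m n : nat) : finType := n.-tuple 'I_m.

Definition wt (m n : nat) (x : word m n) : nat := \sum_(i < n) tnth x i.

Definition weight_range (m n p q : nat) : {set word m n} :=
  [set x : word m n | p <= wt x <= q].

Definition overlap (m n s : nat) : rel (word m n) :=
  fun x y => drop (n - s) x == take s y.

(* The cyclic ordering is a duplicate-free enumeration of S; [cycle] also
   requires the last word to overlap the first one. *)
Definition is_ocycle (m n s : nat) (S : {set word m n}) (c : seq (word m n)) :=
  [/\ uniq c, c =i S & cycle (@overlap m n s) c].

(* Main.v *)
Require Import Defs.
From mathcomp Require Import all_boot.
From mathcomp Require Import fingroup perm zify.

(** Rotating a word by n - s letters permutes the words of weight in [p, q] and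
    sends each word to one that it overlaps, so the rotation cycles form a
    cover by s-ocycles.  Two cycles containing words with the same s-suffix can
    be spliced by swapping the successors of these words.  Splicing as long as
    possible leaves a single cycle: a letter in any position can be rotated
    into the first n - s positions and changed there without affecting the
    suffix, and as p < q, single-letter changes connect all the words. *)

Set Implicit Arguments.
Unset Strict Implicit.
Unset Printing Implicit Defensive.

(** In the application [f] is the suffix and [g] the prefix. Among the permutations meeting the
    first two conditions, one with the fewest cycles meets the third, since any further splice would
    lower that number. *)
Lemma splice_cycles (T : finType) (U : eqType) (f g : T -> U) (S : {set T})
    (s0 : {perm T}) :
    (forall x, f x = g (s0 x)) -> (forall x, (s0 x \in S) = (x \in S)) ->
  exists s : {perm T},
    [/\ forall x, f x = g (s x), forall x, (s x \in S) = (x \in S)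
      & {in S &, forall x y, f x = f y -> porbit s x = porbit s y}].
Proof.
move=> fg0 S0.
pose P (s : {perm T}) :=
  [forall x, f x == g (s x)] && [forall x, (s x \in S) == (x \in S)].
have P0 : P s0.
  by apply/andP; split; apply/forallP=> x; apply/eqP.
case: (arg_minnP (fun s => #|porbits s|) P0) => s /andP[fgs Ss] mins.
have fgE x : f x = g (s x) by apply/eqP/(forallP fgs).
have SE x : (s x \in S) = (x \in S) by apply/eqP/(forallP Ss).
exists s; split=> // x y xS yS fxy; apply/eqP; rewrite eq_porbit_mem.
apply/negPn/negP=> xy.
have neq : x != y by apply: contraNneq xy => ->; apply: porbit_id.
(* For [x] and [y] on distinct cycles, [tperm x y * s] swaps their successors and has exactly one
   cycle fewer. *)
have := porbits_mul_tperm s x y; rewrite /= xy neq.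
suff : P (tperm x y * s)%g.
  by move/mins; set u := #|_|; set v := #|_|; lia.
apply/andP; split; apply/forallP=> z; rewrite permM; apply/eqP;
  by case: tpermP => [->|->|_ _]; rewrite -?fgE ?SE ?xS ?yS.
Qed.

Lemma rot_letter_eq (T : eqType) (z : T) (s t : seq T) (d i : nat) :
    size s = size t -> d <= i < size s ->
    (forall k, k < size s -> k != i -> nth z s k = nth z t k) ->
  forall k, k < size s -> k != i - d -> nth z (rot d s) k = nth z (rot d t) k.
Proof.
move=> st /andP[di iS] E k ks ki.
rewrite /rot !nth_cat !size_drop -st !nth_drop.
case: ltnP => kd; first by apply: E; lia.
by rewrite !nth_take ?E //; lia.
Qed.

Section Words.
Variables m n : nat.
Implicit Types x y : word m n.

(** The position is a plain number, so that [i - d] can be used without a bound proof. The words may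
    also agree at [i]. *)
Definition differ_at (i : nat) x y :=
  forall k : 'I_n, k != i :> nat -> tnth x k = tnth y k.

Definition word_rot (d : nat) x : word m n := [tuple of rot d x].

Lemma word_rot_inj d : injective (word_rot d).
Proof. by move=> x y /(congr1 val) /rot_inj /val_inj. Qed.

Lemma wt_seq x : wt x = \sum_(a <- x) a.
Proof. by rewrite /wt big_tuple. Qed.

Lemma wt_rot d x : wt (word_rot d x) = wt x.
Proof. by rewrite !wt_seq; apply/perm_big/permPl/perm_rot. Qed.

Lemma differ_at_nth (z : 'I_m) i x y :
  differ_at i x y <->
  (forall k, k < n -> k != i -> nth z x k = nth z y k).
Proof.
split=> [E k kn ki | E k ki]; last by rewrite !(tnth_nth z) E.
by have := E (Ordinal kn) ki; rewrite !(tnth_nth z).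
Qed.

Lemma differ_at_rot d i x y :
  d <= i < n -> differ_at i x y ->
  differ_at (i - d) (word_rot d x) (word_rot d y).
Proof.
move=> /[dup] di /andP[_ i_n].
pose z := tnth x (Ordinal i_n).
move=> /(differ_at_nth z) E; apply/(differ_at_nth z) => k kn ki.
by apply: (rot_letter_eq (i := i)); rewrite ?size_tuple.
Qed.

Lemma differ_at_drop d i x y :
  i < d -> differ_at i x y -> drop d x = drop d y.
Proof.
move=> id E; case: (leqP n d) => nd.
  by rewrite !drop_oversize ?size_tuple.
pose z := tnth x (Ordinal nd); move/(differ_at_nth z): E => E.
apply: (@eq_from_nth _ z) => [|k]; first by rewrite !size_drop !size_tuple.
by rewrite size_drop size_tuple => kn; rewrite !nth_drop E //; lia.
Qed.

Definition set_letter x (i : 'I_n) (a : 'I_m) : word m n :=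
  [tuple if k == i then a else tnth x k | k < n].

Lemma tnth_set_letter x i a k :
  tnth (set_letter x i a) k = if k == i then a else tnth x k.
Proof. exact: tnth_mktuple. Qed.

Lemma differ_at_set_letter x (i : 'I_n) a : differ_at i x (set_letter x i a).
Proof. by move=> k ki; rewrite tnth_set_letter -val_eqE (negPf ki). Qed.

(** The crosswise form avoids truncated subtraction. [F] will give both the weight and the distance
    to a target word. *)
Lemma sum_set_letter (F : 'I_n -> nat -> nat) x (i : 'I_n) (a : 'I_m) :
  \sum_k F k (tnth (set_letter x i a) k) + F i (tnth x i) =
  \sum_k F k (tnth x k) + F i a.
Proof.
rewrite (bigD1 i) //= [in RHS](bigD1 i) //= tnth_set_letter eqxx.
rewrite addnAC [RHS]addnAC [F i a + _]addnC; congr (_ + _ + _).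
by apply: eq_bigr => k ki; rewrite tnth_set_letter (negPf ki).
Qed.

(** One of the two truncated differences is zero, so this is an absolute difference. Its sum over
    [i] is the l1 distance to [y], on which the induction below runs. *)
Definition letter_dist (y : word m n) (i : 'I_n) (a : nat) :=
  (a - tnth y i) + (tnth y i - a).

(* As long as x differs from y, some letter of x can be moved one step towards
   the corresponding letter of y without leaving the weight range. *)
Lemma weight_range_connected (p q : nat) (K : Type) (F : word m n -> K) :
    p < q ->
    {in weight_range m n p q &, forall x y,
       (exists i : 'I_n, differ_at i x y) -> F x = F y} ->
  {in weight_range m n p q &, forall x y, F x = F y}.
Proof.
move=> pq loc x y + yS; pose D x := \sum_(i < n) letter_dist y i (tnth x i).
have [N] := ubnP (D x); elim: N x => // N IHN x leD xS.
have [/existsP[i xyi]|/existsPn same] :=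
    boolP [exists i, tnth x i != tnth y i]; last first.
  by congr F; apply: eq_from_tnth => i; apply/eqP/negPn.
have step (j : 'I_n) (a : 'I_m) : p <= wt x - tnth x j + a <= q ->
    letter_dist y j a < letter_dist y j (tnth x j) -> F x = F y.
  move=> ina lt_a; pose x' := set_letter x j a.
  have wtx' := sum_set_letter (fun _ v => v) x j a.
  have Dx' := sum_set_letter (letter_dist y) x j a.
  have le_xj : tnth x j <= wt x by rewrite /wt (bigD1 j) //= leq_addr.
  have x'S : x' \in weight_range m n p q.
    rewrite inE; move: wtx'; rewrite -/(wt x) -/(wt (set_letter x j a)) -/x'.
    by move: ina le_xj; clear; lia.
  rewrite (loc x x') //; last by exists j; apply: differ_at_set_letter.
  apply: IHN => //; move: Dx' lt_a leD; rewrite -/x' -/(D x) -/(D x'); clear; lia.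
have in_range (j : 'I_n) : p <= wt x <= q /\ tnth x j <= wt x.
  by move: xS; rewrite inE /wt => ->; rewrite (bigD1 j) //= leq_addr.
have down (j : 'I_n) : tnth y j < tnth x j -> p < wt x -> F x = F y.
  move=> ltj ltp.
  apply: (step j (Ordinal (leq_ltn_trans (leq_pred _) (ltn_ord (tnth x j))))).
    by move: (in_range j) ltj ltp => /=; case: (tnth x j) => u _ /=; lia.
  move: ltj; rewrite /letter_dist /=.
  by move: (nat_of_ord (tnth x j)) (nat_of_ord (tnth y j)) => u v; lia.
have up (j : 'I_n) : tnth x j < tnth y j -> wt x < q -> F x = F y.
  move=> ltj ltq.
  apply: (step j (Ordinal (leq_ltn_trans ltj (ltn_ord (tnth y j))))).
    by move: (in_range j) ltq => /=; case: (tnth x j) => u _ /=; lia.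
  move: ltj; rewrite /letter_dist /=.
  by move: (nat_of_ord (tnth x j)) (nat_of_ord (tnth y j)) => u v; lia.
have lt_wt (u v : word m n) (j : 'I_n) :
    (forall k, tnth u k <= tnth v k) -> tnth u j < tnth v j -> wt u < wt v.
  move=> le_uv lt_j; rewrite /wt (bigD1 j) //= [in ltnRHS](bigD1 j) //=.
  by rewrite -addSn leq_add // leq_sum.
move: xS yS; rewrite !inE => /andP[px xq] /andP[py yq].
(* A letter of [x] that is too small can be raised unless the weight is already [q]. In that case
   some other letter is too large, as otherwise [wt x < wt y <= q], and [p < q] allows lowering
   it. *)
have [/existsP[j ltj]|/existsPn leyx] :=
    boolP [exists j, tnth x j < tnth y j].
  have [ltq|qx] := ltnP (wt x) q; first exact: up ltj ltq.
  have [/existsP[k ltk]|/existsPn lexy] :=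
    boolP [exists k, tnth y k < tnth x k].
    exact: down ltk (leq_trans pq qx).
  have le_xy k : tnth x k <= tnth y k by rewrite leqNgt.
  by have := leq_trans (lt_wt x y j le_xy ltj) yq; rewrite ltnNge qx.
(* Here [x] dominates [y] and is larger at [i], so [p <= wt y < wt x] leaves room to lower that
   letter. *)
have le_yx k : tnth y k <= tnth x k by rewrite leqNgt.
have lti : tnth y i < tnth x i.
  by rewrite ltn_neqAle le_yx andbT eq_sym; apply: xyi.
exact: down lti (leq_ltn_trans py (lt_wt y x i le_yx lti)).
Qed.
End Words.

Theorem theorem3p5 (m n s p q : nat) (hs : 1 <= s < n)
  (hpq : p < q) (hq : q <= (m - 1) * n) :
  exists c : seq (word m n), is_ocycle s (weight_range m n p q) c.
Proof.
set S := weight_range m n p q; pose d := n - s.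
pose f (x : word m n) := drop d x; pose g (x : word m n) := take s x.
have fgr x : f x = g (word_rot d x).
  rewrite /f /g /= /rot take_cat size_drop size_tuple.
  have -> : n - d = s by rewrite /d; lia.
  by rewrite ltnn subnn take0 cats0.
have rotS x : (word_rot d x \in S) = (x \in S) by rewrite !inE wt_rot.
have [|x|r [fr Sr merge]] :=
  @splice_cycles _ _ f g S (perm (@word_rot_inj m n d)).
- by move=> x; rewrite permE.
- by rewrite permE.
(* The predecessor of [y] under [r] has the same suffix as [x], so [merge] applies to these two. *)
have overlap_porbit x y : x \in S -> y \in S -> f x = g y ->
    porbit r x = porbit r y.
  move=> xS yS fgxy; have rK : r (r^-1%g y) = y by rewrite permKV.
  have -> : porbit r y = porbit r (r^-1%g y).
    apply/eqP; rewrite eq_porbit_mem -{1}rK; exact: (mem_porbit r 1).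
  apply: merge => //; first by rewrite -Sr rK.
  by rewrite fgxy -[in LHS]rK -fr.
have single : {in S &, forall x y, porbit r x = porbit r y}.
  apply: weight_range_connected => // x y + + [i].
  have [k] := ubnP (i : nat); elim: k i x y => // k IHk i x y lek xS yS xy.
  (* A change among the first [d] letters leaves the suffix intact. Otherwise both words are
     replaced by their rotations, which lie on the same cycles of [r] because each word overlaps its
     rotation; the position drops by [d > 0]. *)
  have [id|di] := ltnP i d; first exact/merge/(differ_at_drop id xy).
  rewrite (overlap_porbit x (word_rot d x)) ?rotS //.
  rewrite (overlap_porbit y (word_rot d y)) ?rotS //.
  have i'n : i - d < n by have := ltn_ord i; lia.
  apply: (IHk (Ordinal i'n)); rewrite ?rotS //=; first by rewrite /d; lia.
  by apply: differ_at_rot => //; rewrite di /=.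
have [S0|[x xS]] := set_0Vmem S.
  by exists [::]; split=> // x; rewrite S0 inE.
(* By [single] this cycle of [r] contains all of [S], and it stays in [S] because [r] preserves
   [S]. *)
exists (fingraph.orbit r x); split; first exact: orbit_uniq.
- move=> y; rewrite -fconnect_orbit; apply/idP/idP => [/iter_findex <-|yS].
    by elim: findex => //= k; rewrite Sr.
  have : y \in porbit r x by rewrite -eq_porbit_mem (single y x).
  by case/porbitP => k ->; rewrite permX fconnect_iter.
- apply: sub_cycle (cycle_orbit (@perm_inj _ r) x) => y z /eqP <-.
  by apply/eqP; apply: fr.
Qed.
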